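(* Let $p$ be an odd prime. For $0<k<p$ let $g_k(\alpha)\in\mathbb F_p(\alpha)$ be as defined in the context, and for an integer $d$ and a parameter $\gamma$ put $\pounds_d^{(\gamma)}(X)=\sum_{k=1}^{p-1}g_k(\gamma)X^k/k^d$; also let $\pounds_d(X)=\sum_{k=1}^{p-1}X^k/k^d$. Let $T(X)=\prod_{i=1}^{p-1}(1+X/i)^i$. Then for any integer $d$, \[ \sum_{r=1}^{p-1}\pounds_d^{(r\alpha^p)}\bigl(T(r\alpha)\,X\bigr)=(\alpha^{p-1}-1)\,\pounds_d(X) \] in $\mathbb F_p(\alpha)[X]$.
   Context: For integers $0<k<p$ and $0<a<p$, $e(k,a)$ is the exponent of the highest power of $p$ dividing $\prod_{s=1}^{k}\binom{sa}{a}$, and $g_k(\alpha)=\prod_{0<a<p}(1+\alpha/a)^{-e(k,a)}$ viewed in $\mathbb F_p(\alpha)$. In $\pounds_d^{(r\alpha^p)}$ the parameter $\gamma$ is replaced by $r\alpha^p$ (with $r$ viewed in $\mathbb F_p$); $1/k^d$ is the inverse of $k^d$ in $\mathbb F_p$. *)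

(* Defs.v *)
From HB Require Import structures.
From mathcomp Require Import all_boot all_order all_algebra.
From mathcomp Require Import fraction.

Set Implicit Arguments.
Unset Strict Implicit.
Unset Printing Implicit Defensive.

Import GRing.Theory.
Local Open Scope ring_scope.

(* The field F_p(alpha) of rational functions; elements of F_p occur in it as
   numerals n%:R, which vanish exactly when p divides n (p prime). *)
Notation ratFp p := {fraction {poly 'F_p}}.

Definition alpha (p : nat) : ratFp p := tofrac 'X.

Definition e (p k a : nat) : nat :=
  logn p (\prod_(1 <= s < k.+1) 'C(s * a, a))%N.

(* The value g_k(gamma) of the rational function g_k at a parameter gamma;
   g_k itself is [g k (alpha p)]. *)
Definition g (p k : nat) (gamma : ratFp p) : ratFp p :=
  \prod_(1 <= a < p) (1 + gamma / a%:R) ^- e p k a.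

Definition polylog (p : nat) (d : int) : {poly ratFp p} :=
  \sum_(1 <= k < p) ((k%:R ^ d)^-1 : ratFp p) *: 'X^k.

Definition polylog_param (p : nat) (d : int) (gamma : ratFp p) :
    {poly ratFp p} :=
  \sum_(1 <= k < p) (g k gamma / k%:R ^ d) *: 'X^k.

(* The coefficients of T lie in F_p; it is taken over F_p(alpha) so that it can
   be evaluated there. *)
Definition T (p : nat) : {poly ratFp p} :=
  \prod_(1 <= i < p) (1 + (i%:R^-1 : ratFp p) *: 'X) ^+ i.

(* Main.v *)
Require Import Defs.
From HB Require Import structures.
From mathcomp Require Import all_boot all_order all_algebra.
From mathcomp Require Import fraction ring zify.

Set Implicit Arguments.
Unset Strict Implicit.
Unset Printing Implicit Defensive.

Import GRing.Theory.
Local Open Scope ring_scope.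

(** Since (k a)! = a!^k prod_s C(s a, a), one has e(k, a) = floor(k a / p); with
    r alpha^p = (r alpha)^p this turns g_k(r alpha^p) T(r alpha)^k into
    prod_a (1 + r alpha / a)^(k a mod p) = T(k r alpha).  After permuting the
    residues r, every coefficient of the theorem reduces to one identity for
    U(X) = sum_(r in F_p) T(r X), namely U = X^(p-1).

    From (X^(p-1) - 1) T' = T, the polynomial T is exp(-X) modulo X^p; from
    T(X) X^p = T(X + 1) (X^p - X), r! T(X - r) = X^r T(X) modulo X^p.  Hence the
    coefficient of t^n in U(t - 1), n < p, is
    (1/n!) sum_r (-1)^(n-r) C(n, r) r^n = 1, as in (t - 1)^(p-1).  So
    U - X^(p-1) vanishes to order p at -1, hence at all of F_p^* because it is
    invariant under X -> s X, and its degree is too small for that. *)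

(** * Finite differences and polynomial divisibility *)

(** This is the n-th finite difference of the m-th power at [y]. The shift [y] is kept general
    because the induction on [m] replaces it by [y + 1]. *)
Lemma sum_sign_bin_shift_expr (R : comNzRingType) (m n : nat) (y : R) :
  (m <= n)%N ->
  \sum_(r < n.+1) (-1) ^+ (n - r) * 'C(n, r)%:R * (r%:R + y) ^+ m
    = if m == n then n`!%:R else 0.
Proof.
elim: m n y => [|m IHm] n y le_mn.
  transitivity ((-1 + 1) ^+ n : R); last by rewrite addNr expr0n eq_sym; case: n le_mn.
  by rewrite exprDn; apply: eq_bigr => r _; rewrite expr1n expr0 !mulr1 mulr_natr.
case: n le_mn => // n le_mn.
(* Split one factor [r + y] off the power: the part with [r] is absorbed by r C(n+1, r) = (n+1) C(n,
   r-1), the part with [y] is a difference of order above the degree. *)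
transitivity (n.+1%:R * (\sum_(r < n.+1) (-1) ^+ (n - r) * 'C(n, r)%:R
      * (r%:R + (y + 1)) ^+ m) + y * \sum_(r < n.+2) (-1) ^+ (n.+1 - r)
      * 'C(n.+1, r)%:R * (r%:R + y) ^+ m :> R).
  rewrite 2!big_distrr /=.
  transitivity (\sum_(r < n.+2) ((-1) ^+ (n.+1 - r) * (r * 'C(n.+1, r))%:R
      * (r%:R + y) ^+ m + y * ((-1) ^+ (n.+1 - r) * 'C(n.+1, r)%:R
      * (r%:R + y) ^+ m))).
    by apply: eq_bigr => r _; rewrite exprS natrM; ring.
  rewrite big_split /=; congr (_ + _).
  rewrite big_ord_recl /= mul0n mulr0 mul0r add0r.
  apply: eq_bigr => r _; rewrite /bump /= add1n -mul_bin_diag natrM subSS.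
  by rewrite -[r.+1%:R]natr1 [y + 1]addrC addrA; ring.
rewrite !IHm ?(ltnW le_mn) // [m.+1 == _]eqSS (ltn_eqF le_mn) mulr0 addr0.
by case: eqP => _; rewrite ?mulr0 // -natrM.
Qed.

Lemma sum_sign_bin_expr (R : comNzRingType) (n : nat) :
  \sum_(r < n.+1) (-1) ^+ (n - r) * 'C(n, r)%:R * r%:R ^+ n = n`!%:R :> R.
Proof.
have := @sum_sign_bin_shift_expr R n n 0 (leqnn n); rewrite eqxx => <-.
by apply: eq_bigr => r _; rewrite addr0.
Qed.

Lemma coef_comp_scaleX (R : comNzRingType) (c : R) (P : {poly R}) (n : nat) :
  (P \Po (c *: 'X))`_n = c ^+ n * P`_n.
Proof.
elim/poly_ind: P n => [|P a IHP] n; first by rewrite comp_poly0 !coef0 mulr0.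
rewrite comp_poly_MXaddC -scalerAr coefD coefZ !coefMX coefC coefD coefMX coefC.
case: n => [|n] /=; first by rewrite mulr0 mul1r.
by rewrite IHP !addr0 exprS mulrA.
Qed.

Lemma prod_XsubC_expn_dvdp (F : fieldType) (n : nat) (W : {poly F}) (s : seq F) :
  uniq s -> {in s, forall z, ('X - z%:P) ^+ n %| W} ->
  (\prod_(z <- s) ('X - z%:P)) ^+ n %| W.
Proof.
elim: s => [|z s IHs]; first by rewrite big_nil expr1n dvd1p.
rewrite cons_uniq => /andP[z_s uniq_s] dvdW.
rewrite big_cons exprMn Gauss_dvdp; last first.
  apply/coprimep_expl/coprimep_expr; rewrite coprimep_sym coprimep_XsubC.
  by rewrite root_prod_XsubC.
rewrite dvdW ?mem_head //= IHs // => y ys.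
by apply: dvdW; rewrite inE ys orbT.
Qed.

(** * Residues modulo p and the exponents e(k, a) *)

Lemma perm_mul_mod_iota (p k : nat) : prime p -> (0 < k < p)%N ->
  perm_eq [seq (k * r %% p)%N | r <- index_iota 1 p] (index_iota 1 p).
Proof.
move=> p_pr /andP[k_gt0 lt_kp].
have co_pk : coprime p k by rewrite prime_coprime // gtnNdvd.
have uniqk : uniq [seq (k * r %% p)%N | r <- index_iota 1 p].
  rewrite map_inj_in_uniq ?iota_uniq // => x y.
  rewrite !mem_index_iota => /andP[_ lt_xp] /andP[_ lt_yp] /eqP.
  wlog le_xy : x y lt_xp lt_yp / (x <= y)%N => [IH|].
    by case/orP: (leq_total x y) => ? ?; [|apply/esym]; apply: IH; rewrite // eq_sym.
  rewrite eq_sym eqn_mod_dvd ?leq_mul2l ?le_xy ?orbT // -mulnBr Gauss_dvdr //.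
  rewrite -eqn_mod_dvd // => /eqP; rewrite !modn_small //.
apply: uniq_perm; rewrite ?iota_uniq //.
apply: (uniq_min_size uniqk _ _).2; last by rewrite size_map.
move=> _ /mapP[r + ->]; rewrite !mem_index_iota => /andP[r_gt0 lt_rp].
rewrite ltn_pmod ?(prime_gt0 p_pr) // andbT lt0n -/(dvdn p (k * r)).
by rewrite Gauss_dvdr // gtnNdvd.
Qed.

(** Below p^2 only the first term of Legendre's formula survives. *)
Lemma logn_fact_lt_sqr (p n : nat) : prime p -> (n < p ^ 2)%N ->
  logn p n`! = (n %/ p)%N.
Proof.
move=> p_pr lt_n; rewrite logn_fact //; case: n lt_n => [|n] lt_n.
  by rewrite big_geq // div0n.
rewrite big_ltn // expn1 big1_seq ?addn0 // => k /=.
rewrite mem_index_iota => /andP[le2k _]; rewrite divn_small //.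
by apply: (leq_trans lt_n); rewrite leq_exp2l // prime_gt1.
Qed.

Lemma prod_bin_mul_fact (k a : nat) :
  (\prod_(1 <= s < k.+1) 'C(s * a, a) * a`! ^ k = (k * a)`!)%N.
Proof.
elim: k => [|k IHk]; first by rewrite big_geq.
have := @bin_fact (k.+1 * a) a; rewrite {1 3}mulSn leq_addr addKn => /(_ isT) <-.
by rewrite big_nat_recr //= expnS -IHk; ring.
Qed.

(** As a < p, the factor a!^k is prime to p, so the whole valuation of (k a)! sits in the product of
    binomials. *)
Lemma e_divn (p k a : nat) : prime p -> (k < p)%N -> (a < p)%N ->
  e p k a = (k * a %/ p)%N.
Proof.
move=> p_pr lt_kp lt_ap.
have lt_ka : (k * a < p ^ 2)%N by rewrite expnS expn1 ltn_mul.
rewrite -logn_fact_lt_sqr // -prod_bin_mul_fact lognM ?expn_gt0 ?fact_gt0 //.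
  rewrite lognX logn_fact_lt_sqr ?divn_small ?muln0 ?addn0 //.
  by rewrite (ltn_trans lt_ap) // -{1}[p]expn1 ltn_exp2l // prime_gt1.
rewrite big_seq_cond; apply: prodn_cond_gt0 => s; rewrite andbT mem_index_iota.
by case/andP=> s_gt0 _; rewrite bin_gt0 leq_pmull.
Qed.

(** * The polynomial T over a field of characteristic p *)

(** The product [T] over an arbitrary field; at [ratFp p] it is convertible to [T p]. *)
Definition weightedT (F : fieldType) (p : nat) : {poly F} :=
  \prod_(1 <= i < p) (1 + (i%:R^-1 : F) *: 'X) ^+ i.

Lemma natf_neq0_lt (F : fieldType) (p i : nat) : p \in [pchar F] ->
  (0 < i < p)%N -> i%:R != 0 :> F.
Proof.
by move=> pF /andP[i_gt0 lt_ip]; rewrite -(dvdn_pcharf pF) gtnNdvd.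
Qed.

Lemma natr_inj_lt (F : fieldType) (p : nat) : p \in [pchar F] ->
  {in gtn p &, injective (fun i => i%:R : F)}.
Proof.
move=> pF i j lt_ip lt_jp /= /eqP.
wlog le_ij : i j lt_ip lt_jp / (i <= j)%N => [IH|].
  by case/orP: (leq_total i j) => ? ?; [|apply/esym]; apply: IH; rewrite // eq_sym.
rewrite eq_sym -subr_eq0 -natrB // -(dvdn_pcharf pF) -eqn_mod_dvd // => /eqP.
by rewrite !modn_small.
Qed.

Lemma expr_pchar_nat (R : comNzRingType) (p n : nat) : p \in [pchar R] ->
  n%:R ^+ p = n%:R :> R.
Proof. by move=> pR; have := pFrobenius_aut_nat pR n. Qed.

Lemma exprD_pchar (R : comNzRingType) (p : nat) (x y : R) : p \in [pchar R] ->
  (x + y) ^+ p = x ^+ p + y ^+ p.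
Proof.
by move=> pR; have := pFrobenius_autD_comm pR (mulrC x y).
Qed.

Lemma natr_poly (R : nzRingType) (n : nat) : n%:R = n%:R%:P :> {poly R}.
Proof. by rewrite polyC_natr. Qed.

Lemma prod_XaddnatE (F : fieldType) (p : nat) : p \in [pchar F] ->
  \prod_(0 <= i < p) ('X + i%:R) = 'X^p - 'X :> {poly F}.
Proof.
move=> pF; have p_gt1 := prime_gt1 (pcharf_prime pF).
pose s := [seq - i%:R : F | i <- index_iota 0 p].
have sz : size ('X^p - 'X : {poly F}) = p.+1.
  by rewrite size_polyDl size_polyXn // size_polyN size_polyX ltnS.
rewrite (@all_roots_prod_XsubC _ ('X^p - 'X) s).
- rewrite lead_coefDl ?lead_coefXn ?size_polyXn ?size_polyN ?size_polyX ?ltnS //.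
  rewrite scale1r big_map.
  by apply: eq_bigr => i _; rewrite polyCN opprK natr_poly.
- by rewrite sz size_map size_iota subn0.
- apply/allP => _ /mapP[i _ ->]; rewrite rootE !hornerE.
  have := pFrobenius_autN pF i%:R; rewrite !pFrobenius_autE => ->.
  by rewrite expr_pchar_nat // subrr.
- rewrite uniq_rootsE map_inj_in_uniq ?iota_uniq // => i j.
  rewrite !mem_index_iota /= => lt_i lt_j /oppr_inj.
  exact: (natr_inj_lt pF).
Qed.

(** The constant may stay anonymous: the shift and derivative identities drawn from this form are
    linear in T. *)
Lemma weightedT_XaddE (F : fieldType) (p : nat) : p \in [pchar F] ->
  exists c : F, weightedT F p = c *: \prod_(1 <= i < p) ('X + i%:R) ^+ i.
Proof.
move=> pF; exists (\prod_(1 <= i < p) i%:R ^- i).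
rewrite -mul_polyC rmorph_prod -big_split /=; apply: eq_big_nat => i i_bd.
rewrite -exprVn polyC_exp -exprMn; congr (_ ^+ _).
have i_nz := natf_neq0_lt pF i_bd.
by rewrite mulrDr natr_poly -polyCM mulVf // addrC mul_polyC.
Qed.

(** Substituting X + 1 lowers the exponent of each X + i by one, and the product X^p - X of all the
    X + i restores it. *)
Lemma weightedT_shift (F : fieldType) (p : nat) : p \in [pchar F] ->
  weightedT F p * 'X^p = (weightedT F p \Po ('X + 1)) * ('X^p - 'X).
Proof.
move=> pF; have [c ->] := weightedT_XaddE pF.
have p_gt0 := prime_gt0 (pcharf_prime pF).
rewrite comp_polyZ -!scalerAl; congr (_ *: _).
have p0 : p%:R = 0 :> {poly F} by rewrite natr_poly pcharf0.
rewrite -prod_XaddnatE // rmorph_prod /=.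
(* The factor X^p is the missing term i = p, since p = 0 in the field. *)
transitivity (\prod_(1 <= i < p.+1) ('X + i%:R : {poly F}) ^+ i).
  by rewrite big_nat_recr //= p0 addr0.
transitivity (\prod_(1 <= i < p.+1) (('X + i%:R : {poly F}) ^+ i.-1 * ('X + i%:R))).
  by apply: eq_big_nat => -[//|i] _; rewrite exprSr.
rewrite big_split /= big_ltn // expr0 mul1r big_add1 /=; congr (_ * _).
  apply: eq_big_nat => i _; rewrite rmorphXn /= comp_polyD comp_polyX.
  by rewrite [i%:R]natr_poly comp_polyC -natr_poly -addrA nat1r.
by rewrite big_nat_recr //= p0 [RHS]big_ltn // mulrC.
Qed.

(* Logarithmic derivative, cleared of denominators, with [i = ('X + i) - 'X]. *)
Lemma deriv_prod_Xadd_expn (R : comNzRingType) (m : nat) :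
  let A := \prod_(1 <= i < m.+1) ('X + i%:R : {poly R}) in
  let B := \prod_(1 <= i < m.+1) ('X + i%:R : {poly R}) ^+ i in
  A * B^`() = B * (m%:R * A - 'X * A^`()).
Proof.
elim: m => [|m IHm] /=; first by rewrite !big_geq // -polyC1 !derivC; ring.
rewrite !(big_nat_recr m.+1) //=; move: IHm => /=.
set A := \prod_(_ <= _ < _) _; set B := \prod_(_ <= _ < _) _ => IHm.
have dX : ('X + m.+1%:R : {poly R})^`() = 1.
  by rewrite derivD derivX natr_poly derivC addr0.
rewrite !derivM deriv_exp dX mul1r !exprS /=.
set P := _ ^+ m.
transitivity (('X + m.+1%:R) ^+ 2 * P * (A * B^`())
  + ('X + m.+1%:R) * P * A * B * m.+1%:R); first by ring.
by rewrite IHm; ring.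
Qed.

(** For m = p - 1 the product A is X^(p-1) - 1, so (p-1) A - X A' = -A + X^(p-1) = 1. *)
Lemma weightedT_deriv (F : fieldType) (p : nat) : p \in [pchar F] ->
  ('X^(p.-1) - 1) * (weightedT F p)^`() = weightedT F p.
Proof.
move=> pF; have [c ->] := weightedT_XaddE pF.
have p_gt0 := prime_gt0 (pcharf_prime pF).
rewrite derivZ -scalerAr; congr (_ *: _).
have XA : \prod_(1 <= i < p) ('X + i%:R) = 'X^(p.-1) - 1 :> {poly F}.
  have nzX : 'X != 0 :> {poly F} by rewrite polyX_eq0.
  apply: (mulfI nzX); rewrite mulrBr mulr1 -exprS prednK // -prod_XaddnatE //.
  by rewrite [RHS]big_ltn // addr0.
rewrite -XA -[p in LHS](prednK p_gt0) deriv_prod_Xadd_expn prednK // XA.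
rewrite derivB derivXn -polyC1 derivC polyC1 subr0 -[RHS]mulr1; congr (_ * _).
have p1 : p.-1%:R = -1 :> {poly F}.
  by apply/eqP; rewrite -subr_eq0 opprK natr1 prednK // natr_poly pcharf0.
rewrite p1 mulN1r opprB -mulr_natl p1 mulN1r mulrN opprK.
have [p1_0|p1_gt0] := posnP p.-1; last by rewrite -exprS prednK // subrK.
by have := prime_gt1 (pcharf_prime pF); rewrite -(prednK p_gt0) p1_0.
Qed.

(** A congruence modulo X^p. The shift identity at X - (r+1), where Frobenius gives (X - (r+1))^p =
    X^p - (r+1), yields (r+1) T(X-r-1) = X T(X-r) modulo X^p. *)
Lemma weightedT_shift_nat (F : fieldType) (p r : nat) : p \in [pchar F] ->
  exists Q, r`!%:R *: (weightedT F p \Po ('X - r%:R))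
    = 'X^r * weightedT F p + 'X^p * Q.
Proof.
move=> pF; elim: r => [|r [Q IHr]].
  by exists 0; rewrite subr0 comp_polyXr scale1r mul1r mulr0 addr0.
(* The second summand is r! times the exact cofactor of X^p in that one-step congruence. *)
exists ('X * Q + r`!%:R * ((weightedT F p \Po ('X - r.+1%:R))
  - (weightedT F p \Po ('X - r%:R)))).
have pPF : p \in [pchar {poly F}] by rewrite pchar_poly.
have := congr1 (fun P => P \Po ('X - r.+1%:R)) (weightedT_shift pF).
rewrite !comp_polyM comp_polyB !comp_Xn_poly comp_polyX -comp_polyA.
have -> : ('X + 1) \Po ('X - r.+1%:R) = 'X - r%:R :> {poly F}.
  by rewrite comp_polyD comp_polyX -polyC1 comp_polyC polyC1 -natr1 opprD addrA subrK.
have -> : ('X - r.+1%:R) ^+ p = 'X^p - r.+1%:R :> {poly F}.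
  rewrite exprD_pchar //.
  have := pFrobenius_autN pPF r.+1%:R; rewrite !pFrobenius_autE => ->.
  by rewrite expr_pchar_nat.
move: IHr; rewrite -!mul_polyC -!natr_poly factS natrM exprS.
set T0 := weightedT F p; set T1 := T0 \Po _; set T2 := T0 \Po _.
move=> IHr eqT.
transitivity (r`!%:R * ('X^p * T2 - T2 * ('X^p - r.+1%:R))); first by ring.
rewrite eqT.
transitivity ('X * (r`!%:R * T1) + r`!%:R * 'X^p * (T2 - T1)); first by ring.
by rewrite IHr; ring.
Qed.

Lemma weightedT_horner0 (F : fieldType) (p : nat) : (weightedT F p).[0] = 1.
Proof.
rewrite /weightedT horner_prod big1 // => i _.
by rewrite horner_exp !hornerE expr1n.
Qed.

Lemma coef_weightedT (F : fieldType) (p n : nat) : p \in [pchar F] -> (n < p)%N ->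
  n`!%:R * (weightedT F p)`_n = (-1) ^+ n.
Proof.
move=> pF; elim: n => [|n IHn] lt_np.
  by rewrite -horner_coef0 weightedT_horner0 mul1r.
have := congr1 (fun P : {poly F} => P`_n) (weightedT_deriv pF).
(* Since n < p - 1, the term X^(p-1) T' does not reach degree n, leaving (n+1) t_(n+1) = -t_n. *)
rewrite /= mulrBl mul1r coefB coefXnM ifT; last by rewrite -ltnS prednK ?(leq_trans _ lt_np).
rewrite sub0r coef_deriv => /eqP; rewrite eqr_oppLR => /eqP eqn.
transitivity (n`!%:R * ((weightedT F p)`_n.+1 *+ n.+1)).
  by rewrite factS natrM; ring.
by rewrite eqn mulrN IHn ?(ltnW lt_np) // exprS mulN1r.
Qed.

(** The degree bound (p-1)^2 is coarse, but it stays below the p (p-1) zeros counted later. *)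
Lemma size_weightedT (F : fieldType) (p : nat) : (0 < p)%N ->
  (size (weightedT F p) <= (p.-1 * p.-1).+1)%N.
Proof.
move=> p_gt0; rewrite /weightedT.
suff H m : (size (\prod_(1 <= i < m.+1) (1 + (i%:R^-1 : F) *: 'X) ^+ i)%R
             <= (m * m).+1)%N by have := H p.-1; rewrite prednK.
elim: m => [|m IHm]; first by rewrite big_geq // size_poly1.
rewrite big_nat_recr //=; apply: leq_trans (size_polyMleq _ _) _.
have : (size ((1 + (m.+1%:R^-1 : F) *: 'X) ^+ m.+1)%R <= m.+2)%N.
  apply: leq_trans (size_poly_exp_leq _ _) _; rewrite ltnS -[X in (_ <= X)%N]mul1n.
  rewrite leq_mul2r; apply/orP; right; rewrite -subn1 leq_subLR.
  apply: leq_trans (size_polyD _ _) _; rewrite geq_max size_poly1 /=.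
  by apply: leq_trans (size_scale_leq _ _) _; rewrite size_polyX.
by move: IHm; move: (size _) (size _) => a b; nia.
Qed.

(** * The sum of the dilates of T *)

(** The U of the overview. Its term r = 0 is the constant 1: it completes the alternating binomial
    sum and later supplies the -1 of the theorem. *)
Definition dilate_sum (F : fieldType) (p : nat) : {poly F} :=
  \sum_(0 <= r < p) (weightedT F p \Po (r%:R *: 'X)).

Lemma coef_dilate_sum_shift (F : fieldType) (p n : nat) : p \in [pchar F] ->
  (n < p)%N -> (dilate_sum F p \Po ('X - 1))`_n = 1.
Proof.
move=> pF lt_np; rewrite /dilate_sum rmorph_sum coef_sum /=.
have fact_nz m : (m < p)%N -> m`!%:R != 0 :> F.
  move=> lt_mp; rewrite -(dvdn_pcharf pF).
  have p_pr := pcharf_prime pF.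
  elim: m lt_mp => [|m IHm] lt_mp; first by rewrite dvdn1 neq_ltn prime_gt1 ?orbT.
  by rewrite factS Euclid_dvdM // gtnNdvd //= IHm // ltnW.
transitivity (\sum_(0 <= r < p) if (n < r)%N then 0 else
    n`!%:R^-1 * ((-1) ^+ (n - r) * 'C(n, r)%:R * r%:R ^+ n) : F).
  apply: eq_big_nat => r /andP[_ lt_rp].
  (* T(r (X - 1)) is T(X - r) evaluated at r X, whence the factor r^n in the coefficient. *)
  have -> : weightedT F p \Po (r%:R *: 'X) \Po ('X - 1)
      = weightedT F p \Po ('X - r%:R) \Po (r%:R *: 'X).
    rewrite -!comp_polyA comp_polyZ comp_polyB !comp_polyX scalerBr.
    by rewrite rmorph_nat alg_polyC -natr_poly.
  rewrite coef_comp_scaleX; have [Q eqQ] := weightedT_shift_nat r pF.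
  have := congr1 (fun P : {poly F} => P`_n) eqQ; rewrite /= coefZ coefD !coefXnM lt_np addr0.
  have nz_r := fact_nz _ lt_rp.
  (* For n < r the coefficient vanishes, as r! T(X - r) is X^r T(X) modulo X^p. *)
  case: ltnP => [lt_nr|le_rn] eqn.
    by move/eqP: eqn; rewrite mulf_eq0 (negPf nz_r) /= => /eqP ->; rewrite mulr0.
  have lt_d : (n - r < p)%N by rewrite (leq_ltn_trans (leq_subr _ _)).
  have := coef_weightedT pF lt_d; rewrite -eqn => <-.
  have := bin_fact le_rn => /(congr1 (fun m => m%:R : F)); rewrite !natrM => <-.
  have := fact_nz _ lt_np; rewrite -(bin_fact le_rn) !natrM !mulf_eq0 !negb_or.
  by case/and3P=> *; field; apply/and3P.
rewrite (@big_cat_nat _ _ _ n.+1) //= [X in _ + X]big_nat_cond [X in _ + X]big1 => [|i].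
  rewrite addr0 big_mkord.
  transitivity (n`!%:R^-1 * \sum_(r < n.+1) (-1) ^+ (n - r) * 'C(n, r)%:R * r%:R ^+ n : F).
    by rewrite big_distrr; apply: eq_bigr => r _; rewrite ltnNge -ltnS ltn_ord.
  by rewrite sum_sign_bin_expr mulVf // fact_nz.
by rewrite andbT => /andP[-> _].
Qed.

Lemma natr_mod_pchar (R : nzRingType) (p n : nat) : p \in [pchar R] ->
  (n %% p)%:R = n%:R :> R.
Proof.
by move=> pR; rewrite {2}(divn_eq n p) natrD natrM (pcharf0 pR) mulr0 add0r.
Qed.

Lemma dilate_sum_comp_scaleX (F : fieldType) (p s : nat) : p \in [pchar F] ->
  (0 < s < p)%N -> dilate_sum F p \Po (s%:R *: 'X) = dilate_sum F p.
Proof.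
move=> pF s_bd; have p_pr := pcharf_prime pF.
rewrite /dilate_sum (big_ltn (prime_gt0 p_pr)) comp_polyD scale0r !comp_poly0r comp_polyC.
congr (_ + _); rewrite -[RHS](perm_big _ (perm_mul_mod_iota p_pr s_bd)) big_map /=.
rewrite rmorph_sum; apply: eq_bigr => r _ /=.
by rewrite -comp_polyA comp_polyZ comp_polyX scalerA natr_mod_pchar // natrM mulrC.
Qed.

(** Both sides become X^p - 1 after multiplication by X - 1. *)
Lemma Xsub1_exp_predp (F : fieldType) (p : nat) : p \in [pchar F] ->
  ('X - 1) ^+ p.-1 = \sum_(i < p) 'X^i :> {poly F}.
Proof.
move=> pF; have pPF : p \in [pchar {poly F}] by rewrite pchar_poly.
have nz : 'X - 1 != 0 :> {poly F} by rewrite -polyC1 polyXsubC_eq0.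
apply: (mulfI nz); rewrite -exprS prednK ?prime_gt0 ?(pcharf_prime pF) //.
rewrite -subrX1 exprD_pchar //.
by have := pFrobenius_autN pPF 1; rewrite !pFrobenius_autE expr1n => ->.
Qed.

Lemma dilate_sumE (F : fieldType) (p : nat) : p \in [pchar F] ->
  dilate_sum F p = 'X^(p.-1).
Proof.
move=> pF; have p_pr := pcharf_prime pF; have p_gt1 := prime_gt1 p_pr.
pose W := dilate_sum F p - 'X^(p.-1); apply/eqP; rewrite -subr_eq0 -/W.
have sizeW : (size W <= (p.-1 * p.-1).+1)%N.
  apply: leq_trans (size_polyD _ _) _; rewrite geq_max size_polyN size_polyXn.
  apply/andP; split; last by case: (p) p_gt1 => [|[|q]] //= _; nia.
  apply: leq_trans (size_sum _ _ _) _; apply/bigmax_leqP_seq => r _ _.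
  apply: leq_trans (size_weightedT F (prime_gt0 p_pr)).
  apply/leq_sizeP => j; rewrite coef_comp_scaleX => /(leq_sizeP _ _ (leqnn _)) ->.
  by rewrite mulr0.
have W1 : 'X^p %| W \Po ('X - 1).
  rewrite -[_ \Po _](poly_take_drop p) dvdp_addl ?dvdp_mulIr //.
  suff -> : take_poly p (W \Po ('X - 1)) = 0 by rewrite dvdp0.
  apply/polyP => n; rewrite coef_take_poly coef0; case: ltnP => // lt_np.
  rewrite comp_polyB comp_Xn_poly coefB coef_dilate_sum_shift // Xsub1_exp_predp //.
  rewrite coef_sum (bigD1 (Ordinal lt_np)) //= coefXn eqxx big1 ?addr0 ?subrr //.
  by move=> i /negPf ni; rewrite coefXn eq_sym -val_eqE /= in ni *; rewrite ni.
(* The zero of order p at -1 is carried to -1/s by the invariance of W under X -> s X; for its term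
   X^(p-1) this is Fermat's little theorem. *)
have Ws s : (0 < s < p)%N -> ('X - (- s%:R^-1)%:P) ^+ p %| W.
  move=> s_bd; have nz_s := natf_neq0_lt pF s_bd.
  have -> : W = (W \Po ('X - 1)) \Po (s%:R *: 'X + 1).
    have -> : W \Po ('X - 1) \Po (s%:R *: 'X + 1) = W \Po (s%:R *: 'X).
      rewrite -comp_polyA; congr (_ \Po _).
      by rewrite comp_polyB comp_polyX -polyC1 comp_polyC addrK.
    rewrite comp_polyB comp_Xn_poly dilate_sum_comp_scaleX // exprZn.
    suff -> : s%:R ^+ p.-1 = 1 :> F by rewrite scale1r.
    by apply: (mulfI nz_s); rewrite -exprS prednK ?prime_gt0 // expr_pchar_nat // mulr1.
  have -> : s%:R *: 'X + 1 = s%:R *: ('X - (- s%:R^-1)%:P) :> {poly F}.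
    by rewrite polyCN opprK scalerDr -[_ *: _%:P]mul_polyC -polyCM mulfV.
  case/dvdpP: W1 => Q ->; rewrite comp_polyM comp_Xn_poly exprZn.
  by rewrite dvdp_mull // dvdpZr ?expf_neq0.
pose zs := [seq - s%:R^-1 : F | s <- index_iota 1 p].
have uniq_zs : uniq zs.
  rewrite map_inj_in_uniq ?iota_uniq // => i j; rewrite !mem_index_iota.
  by move=> /andP[_ lt_i] /andP[_ lt_j] /oppr_inj /invr_inj; apply: (natr_inj_lt pF).
have dvdW : (\prod_(z <- zs) ('X - z%:P)) ^+ p %| W.
  apply: prod_XsubC_expn_dvdp => // _ /mapP[s + ->].
  by rewrite mem_index_iota => /Ws.
have [//|nzW] := eqVneq W 0.
(* A nonzero W would have p - 1 distinct zeros of order p, hence degree at least p (p-1) >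
   (p-1)^2. *)
have := dvdp_leq nzW dvdW; rewrite leqNgt (leq_ltn_trans sizeW) //.
have szP : size (\prod_(z <- zs) ('X - z%:P)) = p.
  by rewrite size_prod_XsubC size_map size_iota subn1 prednK // prime_gt0.
have nzP : \prod_(z <- zs) ('X - z%:P) != 0 by rewrite -size_poly_gt0 szP prime_gt0.
have := size_exp (\prod_(z <- zs) ('X - z%:P)) p; rewrite szP.
have : (0 < size ((\prod_(z <- zs) ('X - z%:P)) ^+ p)%R)%N.
  by rewrite size_poly_gt0 expf_neq0.
by move: (size _) => a; case: (p) p_gt1 => [|[|q]] //= _; nia.
Qed.

(** * Evaluation of T at multiples of a point *)

Lemma sum_weightedT_mul (F : fieldType) (p k : nat) (x : F) : p \in [pchar F] ->
  (0 < k < p)%N ->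
  \sum_(1 <= r < p) (weightedT F p).[k%:R * (r%:R * x)] = x ^+ p.-1 - 1.
Proof.
move=> pF k_bd; have p_pr := pcharf_prime pF.
have := congr1 (fun P => P.[x]) (dilate_sumE pF).
rewrite /dilate_sum big_ltn ?prime_gt0 // scale0r comp_poly0r -horner_coef0.
rewrite weightedT_horner0 !hornerE => <-; rewrite [1 + _]addrC addrK horner_sum.
rewrite -[RHS](perm_big _ (perm_mul_mod_iota p_pr k_bd)) big_map /=.
apply: eq_bigr => r _.
by rewrite horner_comp hornerZ hornerX natr_mod_pchar // natrM mulrA.
Qed.

(** Reindex the factors by i = k a mod p: then k x / i = x / a and the exponent is the residue. *)
Lemma weightedT_horner_mul (F : fieldType) (p k : nat) (x : F) :
  p \in [pchar F] -> (0 < k < p)%N ->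
  (weightedT F p).[k%:R * x] = \prod_(1 <= a < p) (1 + x / a%:R) ^+ (k * a %% p).
Proof.
move=> pF k_bd; have p_pr := pcharf_prime pF.
rewrite /weightedT horner_prod -(perm_big _ (perm_mul_mod_iota p_pr k_bd)) big_map.
apply: eq_big_nat => a a_bd; rewrite horner_exp hornerD hornerZ hornerX hornerC.
rewrite natr_mod_pchar // natrM.
have nz_k := natf_neq0_lt pF k_bd; have nz_a := natf_neq0_lt pF a_bd.
by congr ((1 + _) ^+ _); field; apply/andP.
Qed.

(** As a^p = a, 1 + x^p / a = (1 + x / a)^p, so the exponent of 1 + x / a drops from k a to k a mod
    p. Nonvanishing allows the cancellation. *)
Lemma prod_exp_horner_weightedT (F : fieldType) (p k : nat) (x : F) :
  p \in [pchar F] -> (0 < k < p)%N ->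
  (forall a, (0 < a < p)%N -> 1 + x / a%:R != 0) ->
  (\prod_(1 <= a < p) (1 + x ^+ p / a%:R) ^- (k * a %/ p))
    * (weightedT F p).[x] ^+ k = (weightedT F p).[k%:R * x].
Proof.
move=> pF k_bd nzx; have p_gt1 := prime_gt1 (pcharf_prime pF).
rewrite weightedT_horner_mul // -[x in (weightedT F p).[x]]mul1r.
rewrite (@weightedT_horner_mul _ _ 1) // -prodrXl -big_split.
apply: eq_big_nat => a a_bd /=; have nz := nzx a a_bd.
have -> : 1 + x ^+ p / a%:R = (1 + x / a%:R) ^+ p.
  by rewrite exprD_pchar // expr1n expr_div_n expr_pchar_nat.
case/andP: a_bd => _ lt_ap; rewrite mul1n (modn_small lt_ap) -!exprM [(a * k)%N]mulnC.
rewrite {2}(divn_eq (k * a) p) exprD [(p * _)%N]mulnC mulrA mulVf ?mul1r //.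
by rewrite expf_neq0.
Qed.

(** * The field of rational functions and the final identity *)

Lemma pchar_ratFp (p : nat) : prime p -> p \in [pchar ratFp p].
Proof.
move=> p_pr; rewrite inE /= p_pr -tofrac1 -tofracMn tofrac_eq0.
by rewrite natr_poly polyC_eq0 pchar_Fp_0.
Qed.

Lemma one_plus_alpha_neq0 (p r a : nat) : prime p -> (0 < r < p)%N -> (0 < a < p)%N ->
  1 + r%:R * alpha p / a%:R != 0.
Proof.
move=> p_pr r_bd a_bd; have pF := pchar_ratFp p_pr.
have nz_a := natf_neq0_lt pF a_bd.
have -> : 1 + r%:R * alpha p / a%:R = tofrac (r%:R *: 'X + a%:R%:P) / a%:R.
  rewrite tofracD -mul_polyC tofracM -!natr_poly -/(alpha p) !rmorph_nat.
  by rewrite mulrDl mulfV // addrC.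
(* The numerator r X + a is nonzero by its coefficient of X. *)
rewrite mulf_neq0 ?invr_eq0 // tofrac_eq0; apply/eqP => /(congr1 (fun P : {poly 'F_p} => P`_1)).
rewrite coefD coefZ coefX coefC coef0 mulr1 addr0 => /eqP; apply/negP.
exact: natf_neq0_lt (pchar_Fp p_pr) r_bd.
Qed.

Theorem theorem7 (p : nat) (p_prime : prime p) (p_odd : odd p) (d : int) :
  \sum_(1 <= r < p)
     (polylog_param d (r%:R * alpha p ^+ p) \Po ((T p).[r%:R * alpha p] *: 'X))
  = (alpha p ^+ (p - 1) - 1) *: polylog p d.
Proof.
have pF := pchar_ratFp p_prime.
rewrite -[T p]/(weightedT _ p) /polylog_param /polylog scaler_sumr.
under eq_bigr do rewrite rmorph_sum.
(* With the sum over k outermost, the coefficients of each X^k can be compared. *)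
rewrite exchange_big; apply: eq_big_nat => k k_bd /=.
under eq_bigr do rewrite comp_polyZ comp_Xn_poly exprZn scalerA.
rewrite -scaler_suml scalerA; congr (_ *: _).
rewrite subn1 -(sum_weightedT_mul (alpha p) pF k_bd) big_distrl.
apply: eq_big_nat => r r_bd /=.
rewrite -prod_exp_horner_weightedT //; last by move=> a; apply: one_plus_alpha_neq0.
rewrite mulrAC; congr (_ * _ / _).
(* As r^p = r, the parameter r alpha^p is the p-th power of r alpha. *)
rewrite /g exprMn expr_pchar_nat //; apply: eq_big_nat => a /andP[_ lt_ap].
by case/andP: k_bd => _ lt_kp; rewrite e_divn.
Qed.
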